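(* With the setting and notation of the context, let $l_1\geqslant l_2$ be positive integers with $l_1+l_2=c+r+n$ $(=N)$, and let $1\leqslant i_1<\cdots<i_{l_1}\leqslant c+r$ and $1\leqslant j_1<\cdots<j_{l_2}\leqslant c$ be two ascending sequences of indices with $\{j_1,\dots,j_{l_2}\}\subset\{i_1,\dots,i_{l_1}\}$. Then the global regular symmetric horizontal differential $l_2$-form $\widehat\omega_{j_1,\dots,j_{l_2}}^{i_1,\dots,i_{l_1}}$ on $\widehat X$ is the image of a global twisted regular symmetric differential $l_2$-form $$\omega_{j_1,\dots,j_{l_2}}^{i_1,\dots,i_{l_1}}\in\Gamma\big(X,\mathsf{Sym}^{l_2}\,\Omega_V(\heartsuit)\big)$$ under the canonical injection $\Gamma\big(X,\mathsf{Sym}^{l_2}\Omega_V(\heartsuit)\big)\hookrightarrow\Gamma\big(\widehat X,\mathsf{Sym}^{l_2}\Omega_{\mathrm{hor}}\widehat V\big)$, where $$\heartsuit:=\sum_{p=1}^{l_1}\deg F_{i_p}+\sum_{q=1}^{l_2}\deg F_{j_q}-\sum_{j=0}^{N}\lambda_j+N+1 .$$ Moreover, for all homogeneous polynomials $P\in\Gamma(\mathbb{P}^N,\mathcal{O}_{\mathbb{P}^N}(\deg P))$, multiplication gives further global twisted regular symmetric differential $l_2$-forms $$P\,\omega_{j_1,\dots,j_{l_2}}^{i_1,\dots,i_{l_1}}\in\Gamma\big(X,\mathsf{Sym}^{l_2}\,\Omega_V(\deg P+\heartsuit)\big).$$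
   Context: $\mathbb{K}$ is an algebraically closed field; $N\geqslant 2$ and $c,r\geqslant 0$ are integers with $2c+r\geqslant N$, $c+r\leqslant N-1$, and $n:=N-(c+r)\geqslant 1$. Let $d_1,\dots,d_{c+r}$ and $\lambda_0,\dots,\lambda_N$ be positive integers, and let $$F_i=\sum_{j=0}^N A_i^j\,z_j^{\lambda_j}\qquad(i=1,\dots,c+r),$$ where $A_i^j\in\mathbb{K}[z_0,\dots,z_N]$ are homogeneous with $\deg A_i^j+\lambda_j=\deg F_i=d_i$. Let $V=\{F_1=\cdots=F_c=0\}\subset\mathbb{P}^N_{\mathbb{K}}$ and $X=\{F_1=\cdots=F_{c+r}=0\}\subset V$, both assumed to be smooth complete intersections. Let $\pi:\mathbb{K}^{N+1}\setminus\{0\}\to\mathbb{P}^N_{\mathbb{K}}$ be the projection, $\widehat V=\pi^{-1}(V)$, $\widehat X=\pi^{-1}(X)$. The horizontal tangent bundle $\mathrm{T}_{\mathrm{hor}}\widehat V$ has fibre $\{[\xi]\in\mathbb{K}^{N+1}/\mathbb{K}z: dF_i|_z(\xi)=0,\ i=1,\dots,c\}$ at $z\in\widehat V$; $\Omega_{\mathrm{hor}}\widehat V$ is its dual; and $\mathsf{Sym}^l\Omega_V(\heartsuit):=\mathsf{Sym}^l\Omega_V\otimes\mathcal{O}_V(\heartsuit)$. There is a canonical injection $\Gamma(X,\mathsf{Sym}^l\Omega_V(\heartsuit))\hookrightarrow\Gamma(\widehat X,\mathsf{Sym}^l\Omega_{\mathrm{hor}}\widehat V)$ (pullback by $\pi$)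 whose image is the set of sections $\Phi$ with $\Phi(\lambda z,[\lambda\xi])=\lambda^{\heartsuit}\Phi(z,[\xi])$ for all $z\in\widehat X$, $[\xi]\in\mathrm{T}_{\mathrm{hor}}\widehat V|_z$, $\lambda\in\mathbb{K}^\times$. Set $\widetilde{\mathsf A}_i^j:=A_i^jz_j$ and $\mathsf B_i^j:=z_j\,dA_i^j+\lambda_jA_i^j\,dz_j$, so that $F_i=\sum_j\widetilde{\mathsf A}_i^jz_j^{\lambda_j-1}$ and $dF_i=\sum_j\mathsf B_i^jz_j^{\lambda_j-1}$. Let $\mathsf C$ be the $(c+r+c)\times(N+1)$ matrix whose $i$-th row is $(\widetilde{\mathsf A}_i^0,\dots,\widetilde{\mathsf A}_i^N)$ for $i=1,\dots,c+r$ and whose $(c+r+i)$-th row is $(\mathsf B_i^0,\dots,\mathsf B_i^N)$ for $i=1,\dots,c$. Let $\mathsf C_{j_1,\dots,j_{l_2}}^{i_1,\dots,i_{l_1}}$ be the submatrix consisting of the rows $i_1,\dots,i_{l_1},c+r+j_1,\dots,c+r+j_{l_2}$, and let $\widehat{\mathsf C}_{j_1,\dots,j_{l_2};j}^{i_1,\dots,i_{l_1}}$ be the square submatrix obtained from it by omitting the $(j+1)$-th column. On $\widehat X\cap\{z_j\neq0\}$ put $$\widehat\omega_{j_1,\dots,j_{l_2};j}^{i_1,\dots,i_{l_1}}:=\frac{(-1)^j}{z_j^{\lambda_j-1}}\det\Big(\widehat{\mathsf C}_{j_1,\dots,j_{l_2};j}^{i_1,\dots,i_{l_1}}\Big)\qquad(j=0,\dots,N),$$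 where $1$-forms are multiplied in the symmetric algebra. These $N+1$ local forms are sections of $\mathsf{Sym}^{l_2}\Omega_{\mathrm{hor}}\widehat V$ which agree on overlaps, and $\widehat\omega_{j_1,\dots,j_{l_2}}^{i_1,\dots,i_{l_1}}\in\Gamma(\widehat X,\mathsf{Sym}^{l_2}\Omega_{\mathrm{hor}}\widehat V)$ denotes the form obtained by gluing them. *)

(* Defs.v *)
From mathcomp Require Import all_boot all_order all_algebra.
From mathcomp Require Export mpoly.

Set Implicit Arguments.
Unset Strict Implicit.
Unset Printing Implicit Defensive.

Import GRing.Theory.
Local Open Scope ring_scope.

(* Symmetric differential forms on K^(N+1) with polynomial coefficients:
   the symmetric algebra K[z_0..z_N][dz_0..dz_N] of the differentials of
   K[z_0..z_N]. The outer variable 'X_k is dz_k; p%:MP is the 0-form p. *)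
Notation symform K N := {mpoly {mpoly K[N.+1]}[N.+1]}.

Section Forms.
Variables (K : closedFieldType) (N : nat).
Local Notation W := 'rV[K]_N.+1.
Local Notation S := {mpoly K[N.+1]}.
Implicit Types (z xi u : W) (L : {vspace W}) (f g : 'End(W)).

Definition dform (p : S) : symform K N := \sum_(k < N.+1) (p^`M(k))%:MP * 'X_k.

(* Value at the point z on the vector xi. As K is infinite, an element of the
   l-th symmetric power of a dual space is the same thing as the homogeneous
   polynomial function of degree l it defines, so sections of symmetric powers
   of cotangent bundles are handled below through their values. *)
Definition feval (G : symform K N) z xi : K :=
  (G.@[fun k => (xi 0 k)%:MP]).@[z 0].

Section Zeros.
Variables (m : nat) (E : 'I_m -> S).

Definition in_cone z : Prop := z != 0 /\ forall i, (E i).@[z 0] = 0.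

(* Jacobian criterion, at every point of the scheme E = 0 of P^N: it is smooth
   of codimension m. *)
Definition smooth_ci : Prop := forall z, in_cone z ->
  row_free (\matrix_(i < m, k < N.+1) ((E i)^`M(k)).@[z 0]).

(* The class of xi modulo z is in the fibre at z of the horizontal tangent
   bundle. *)
Definition horizontal z xi : Prop :=
  forall i, feval (dform (E i)) z xi = 0.

(* Points of P^N are the lines L of K^(N+1). *)
Definition in_proj L : Prop :=
  \dim L = 1%N /\ forall u, u \in L -> forall i, (E i).@[u 0] = 0.

(* Tangent vectors of P^N at L are the linear maps L -> K^(N+1) / L; such a
   map is given by a lift f to an endomorphism of K^(N+1), and two lifts
   represent the same tangent vector when they agree on L modulo L. *)
Definition tangent L f : Prop :=
  forall u, u \in L -> horizontal u (f u).

End Zeros.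

Definition same_tangent L f g : Prop := forall u, u \in L -> f u - g u \in L.

Section Sections.
(* EV are the equations of V, EX those of X. *)
Variables (a b : nat) (EV : 'I_a -> S) (EX : 'I_b -> S).

(* Regular sections over the cone of X of the l-th symmetric power of the dual
   of the horizontal tangent bundle of the cone of V. *)
Definition hor_section (l : nat) (Phi : W -> W -> K) : Prop :=
  (forall z xi t, in_cone EX z -> horizontal EV z xi ->
     Phi z (xi + t *: z) = Phi z xi) /\
  (forall z0, in_cone EX z0 ->
     exists (q : S) (G : symform K N),
       [/\ q.@[z0 0] != 0, G \is l.-homog &
           forall z xi, in_cone EX z -> horizontal EV z xi -> q.@[z 0] != 0 ->
             Phi z xi = feval G z xi / q.@[z 0]]).

Definition hor_eq (Phi Psi : W -> W -> K) : Prop :=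
  forall z xi, in_cone EX z -> horizontal EV z xi -> Phi z xi = Psi z xi.

(* The differentials dx_j of the affine coordinates x_j = z_j / z_k on the
   chart z_k <> 0, on the tangent vector z |-> xi at the line of z. *)
Definition dchart (k : 'I_N.+1) z xi : W :=
  \row_j ((z 0 k * xi 0 j - z 0 j * xi 0 k) / z 0 k ^+ 2).

(* Sections over X of Sym^l Omega_V (h). The fibre of O(h) at L is the space
   of functions w on L \ {0} with w (t u) = t^h w u, so a section has a value
   omega L f u for L in X, f tangent to V at L and u in L \ {0}. Regularity:
   near each point of X, in some chart, omega is a combination
     (sum_alpha p_alpha / q * dx^alpha) * z_k ^ h
   of the monomials of degree l in the dx_j and of the generator z_k ^ h of
   O(h), with p_alpha and q homogeneous of the same degree e; the p_alpha are
   the coefficients of G. *)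
Definition twisted_section (l : nat) (h : int)
    (omega : {vspace W} -> 'End(W) -> W -> K) : Prop :=
  [/\ forall L f g, in_proj EX L -> tangent EV L f -> tangent EV L g ->
        same_tangent L f g ->
        forall u, u \in L -> u != 0 -> omega L f u = omega L g u,
      forall L f, in_proj EX L -> tangent EV L f ->
        forall u t, u \in L -> u != 0 -> t != 0 ->
          omega L f (t *: u) = t ^ h * omega L f u
    & forall L0, in_proj EX L0 ->
      exists (k : 'I_N.+1) (e : nat) (q : S) (G : symform K N),
      [/\ q \is e.-homog, forall m : 'X_{1..N.+1}, G@_m \is e.-homog,
          G \is l.-homog,
          forall u, u \in L0 -> u != 0 -> u 0 k != 0 /\ q.@[u 0] != 0
        & forall L f u, in_proj EX L -> tangent EV L f -> u \in L ->
            u 0 k != 0 -> q.@[u 0] != 0 ->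
            omega L f u =
              feval G u (dchart k u (f u)) / q.@[u 0] * u 0 k ^ h]].

End Sections.

(* The differential at z of the projection pi to P^N sends xi to the tangent
   vector L -> K^(N+1) / L, z |-> [xi], at the line L of z. *)
Definition dpi z xi : 'End(W) := linfun (mulmxr (pinvmx z *m xi)).

Lemma dpiE z xi : z != 0 -> dpi z xi z = xi.
Proof.
move=> z0; rewrite lfunE /= mulmxA mulmxVp ?mul1mx //.
by rewrite /row_free rank_rV z0.
Qed.

Definition pi_pullback (omega : {vspace W} -> 'End(W) -> W -> K) z xi : K :=
  omega <[z]>%VS (dpi z xi) z.

(* Multiplication O(deg P) (x) O(h) -> O(deg P + h). *)
Definition form_mul (P : S) (omega : {vspace W} -> 'End(W) -> W -> K)
    : {vspace W} -> 'End(W) -> W -> K :=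
  fun L f u => P.@[u 0] * omega L f u.

Section Fermat.
Variables (c r : nat) (A : 'I_(c + r) -> 'I_N.+1 -> S) (lambda : 'I_N.+1 -> nat).

Definition FX (i : 'I_(c + r)) : S := \sum_(j < N.+1) A i j * 'X_j ^+ lambda j.
Definition FV (i : 'I_c) : S := FX (lshift r i).

Definition matA : 'M[symform K N]_(c + r, N.+1) :=
  \matrix_(i, j) (A i j * 'X_j)%:MP.
Definition matB : 'M[symform K N]_(c, N.+1) :=
  \matrix_(i, j) (('X_j)%:MP * dform (A (lshift r i) j)
                  + (lambda j)%:R * (A (lshift r i) j)%:MP * 'X_j).
Definition matC : 'M[symform K N]_(c + r + c, N.+1) := col_mx matA matB.

Section Minors.
Variables (l1 l2 : nat) (hl : (l1 + l2)%N = N).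
Variables (I : 'I_l1 -> 'I_(c + r)) (J : 'I_l2 -> 'I_c).

Definition row_sel (p : 'I_(l1 + l2)) : 'I_(c + r + c) :=
  match split p with
  | inl s => lshift c (I s)
  | inr s => rshift (c + r) (J s)
  end.

Definition hatC (j : 'I_N.+1) : 'M[symform K N]_N :=
  castmx (hl, erefl N) (col' j (rowsub row_sel matC)).

Definition omega_hat_loc (j : 'I_N.+1) z xi : K :=
  (-1) ^+ j / z 0 j ^+ (lambda j - 1) * feval (\det (hatC j)) z xi.

(* Phi is the form glued from the local ones; it is determined on its domain,
   which is covered by the open sets z_j <> 0. *)
Definition glued_omega_hat (Phi : W -> W -> K) : Prop :=
  forall (j : 'I_N.+1) z xi, in_cone FX z -> horizontal FV z xi ->
    z 0 j != 0 -> Phi z xi = omega_hat_loc j z xi.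

End Minors.

Definition heart (d : 'I_(c + r) -> nat) (l1 l2 : nat)
    (I : 'I_l1 -> 'I_(c + r)) (J : 'I_l2 -> 'I_c) : int :=
  \sum_(p < l1) (d (I p))%:Z + \sum_(q < l2) (d (lshift r (J q)))%:Z
  - \sum_(j < N.+1) (lambda j)%:Z + N%:Z + 1.

End Fermat.
End Forms.

(* Main.v *)
(** Write M for the N x (N+1) matrix of the selected rows of C at (z, xi). On
   the horizontal bundle over the cone of X the vector (z_j ^ (lambda_j - 1))_j
   is in the kernel of M, hence proportional to the signed maximal minors of M:
   this glues the local forms. Let G_k be the k-th signed minor multiplied by
   z_k ^ (sum_(j <> k) lambda_j). It is homogeneous separately in z and in dz,
   of degrees e := l1 + (sum of the degrees of the selected rows) and l2, and
   the glued form is G_k / z_k ^ (Lambda - 1) with Lambda := sum_j lambda_j.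
   By Euler's formula G_k does not change when a multiple of z is added to xi,
   so the form descends to X, with twist e + l2 - (Lambda - 1). *)

Require Import Defs.
From HB Require Import structures.
From mathcomp Require Import all_boot all_order all_algebra.
From mathcomp Require Import mpoly ring.

Set Implicit Arguments.
Unset Strict Implicit.
Unset Printing Implicit Defensive.

Import GRing.Theory.
Local Open Scope ring_scope.

(** * Homogeneous polynomials: scaling and Euler's formula *)

Section Homogeneous.
Variables (R : comNzRingType) (n : nat).
Implicit Types (p : {mpoly R[n]}) (v : 'I_n -> R).

Lemma prod_exp_mdeg (t : R) (m : 'X_{1..n}) :
  \prod_(i < n) t ^+ m i = t ^+ mdeg m.
Proof. by rewrite mdegE -expr_sum. Qed.

Lemma dhomog_mevalZ d p (t : R) v : p \is d.-homog ->
  p.@[fun i => t * v i] = t ^+ d * p.@[v].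
Proof.
move=> /dhomog_mf pd; rewrite !mevalE mulr_sumr; apply: eq_big_seq => m /pd <-.
under eq_bigr do rewrite exprMn.
by rewrite big_split /= prod_exp_mdeg mulrCA.
Qed.

(** A monomial is an eigenvector of each operator [X_k] d/d[X_k], with its [k]-th exponent as
    eigenvalue; the exponents add up to [d]. *)
Lemma dhomog_euler d p : p \is d.-homog ->
  \sum_(k < n) p^`M(k) * 'X_k = d%:R *: p.
Proof.
move=> /dhomog_mf pd; rewrite [in RHS](mpolyE p) scaler_sumr.
have derX (k : 'I_n) (m : 'X_{1..n}) :
    ('X_[m])^`M(k) * 'X_k = (m k)%:R *: 'X_[m] :> {mpoly R[n]}.
  rewrite mderivX -scalerAl -mpolyXD.
  have [->|mk] := eqVneq (m k) 0%N; first by rewrite !scale0r.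
  by rewrite submK // lep1mP.
under eq_bigr => k _.
  rewrite [in p^`M(k)](mpolyE p) raddf_sum mulr_suml.
  under eq_bigr => m _ do rewrite /= mderivZ -scalerAl derX scalerA mulrC -scalerA.
  over.
rewrite exchange_big; apply: eq_big_seq => m /pd <- /=.
by rewrite -scaler_suml -natr_sum mdegE.
Qed.

Lemma dhomogXU_exp (k : 'I_n) e : ('X_k ^+ e : {mpoly R[n]}) \is e.-homog.
Proof. by rewrite -[e in e.-homog]mul1n dhomogMn // dhomogX; apply/eqP/mdeg1. Qed.

End Homogeneous.

(** * Bihomogeneous symmetric forms and their values *)

Section Forms.
Variables (K : closedFieldType) (N : nat).
Local Notation W := 'rV[K]_N.+1.
Local Notation S := {mpoly K[N.+1]}.
Implicit Types (z xi u : W) (p q : S) (G H : symform K N).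

Definition bihomog (e l : nat) G :=
  G \is l.-homog /\ forall m : 'X_{1..N.+1}, G@_m \is e.-homog.

Lemma bihomog0 e l : bihomog e l 0.
Proof. by split=> [|m]; rewrite ?mcoeff0 rpred0. Qed.

Lemma bihomogD e l G H : bihomog e l G -> bihomog e l H -> bihomog e l (G + H).
Proof. by move=> [G1 G2] [H1 H2]; split=> [|m]; rewrite ?mcoeffD rpredD. Qed.

Lemma bihomogM e l e' l' G H : bihomog e l G -> bihomog e' l' H ->
  bihomog (e + e') (l + l') (G * H).
Proof.
move=> [G1 G2] [H1 H2]; split=> [|m]; first exact: dhomogM.
by rewrite mcoeffM rpred_sum // => k _; apply: dhomogM.
Qed.

Lemma bihomogC e p : p \is e.-homog -> bihomog e 0 p%:MP.
Proof.
move=> pe; split=> [|m]; last by rewrite mcoeffC mulr_natr rpredMn.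
by rewrite -[p%:MP]mulr1 mul_mpolyC rpredZ // dhomog1.
Qed.

Lemma bihomogX k : bihomog 0 1 'X_k.
Proof.
split=> [|m]; first by rewrite dhomogX; apply/eqP/mdeg1.
by rewrite mcoeffX; case: eqP => _; rewrite ?rpred0 // dhomog1.
Qed.

Lemma bihomog_sum e l (T : Type) (s : seq T) (P : pred T) (F : T -> symform K N) :
  (forall i, P i -> bihomog e l (F i)) -> bihomog e l (\sum_(i <- s | P i) F i).
Proof.
by move=> hF; elim/big_ind: _ => //; [apply: bihomog0 | apply: bihomogD].
Qed.

Lemma bihomog_prod (T : Type) (s : seq T) (P : pred T) (e l : T -> nat)
    (F : T -> symform K N) :
  (forall i, P i -> bihomog (e i) (l i) (F i)) ->
  bihomog (\sum_(i <- s | P i) e i) (\sum_(i <- s | P i) l i)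
    (\prod_(i <- s | P i) F i).
Proof.
move=> hF; elim/big_ind3: _ => // [|e1 e2 G l1 l2 H H1 H2].
  by rewrite -mpolyC1; apply/bihomogC/dhomog1.
exact: bihomogM.
Qed.

Lemma bihomog_sign e l b G : bihomog e l G -> bihomog e l ((-1) ^+ b * G).
Proof.
move=> [G1 G2]; split=> [|m]; rewrite -signr_odd mulr_sign; case: ifP => _ //.
  by rewrite rpredN.
by rewrite mcoeffN rpredN.
Qed.

(** Each term of the Leibniz expansion takes one entry from every row, so bidegrees that depend only
    on the row add up. *)
Lemma bihomog_det n (M : 'M[symform K N]_n) (e l : 'I_n -> nat) :
  (forall i j, bihomog (e i) (l i) (M i j)) ->
  bihomog (\sum_i e i) (\sum_i l i) (\det M).
Proof.
move=> hM; apply: bihomog_sum => s _; apply: bihomog_sign.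
exact: bihomog_prod.
Qed.

(* feval with its form argument last, so that it can be a ring morphism. *)
Definition fev z xi : symform K N -> K :=
  meval (z 0) \o meval (fun k => (xi 0 k)%:MP).

HB.instance Definition _ z xi := GRing.RMorphism.on (fev z xi).

Lemma fevE z xi G : feval G z xi = fev z xi G. Proof. by []. Qed.

Lemma fevM z xi G H : fev z xi (G * H) = fev z xi G * fev z xi H.
Proof. exact: rmorphM. Qed.

Lemma fevC z xi p : fev z xi p%:MP = p.@[z 0].
Proof. by rewrite /fev /= mevalC. Qed.

Lemma fevX z xi k : fev z xi 'X_k = xi 0 k.
Proof. by rewrite /fev /= mevalXU mevalC. Qed.

Lemma fev_det n z xi (M : 'M[symform K N]_n) :
  fev z xi (\det M) = \det (map_mx (fev z xi) M).
Proof. by rewrite det_map_mx. Qed.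

(** The scalars are independent: [s = t] yields the twist on the cone, [s = 1] the passage to an
    affine chart. *)
Lemma fevZ e l G s t z xi : bihomog e l G ->
  fev (s *: z) (t *: xi) G = s ^+ e * t ^+ l * fev z xi G.
Proof.
move=> [/dhomog_mf Gl Ge]; rewrite /fev /= !(mevalE _ G) !rmorph_sum mulr_sumr /=.
apply: eq_big_seq => m /Gl <-; rewrite !mevalM !rmorph_prod /=.
under eq_bigr do rewrite rmorphXn /= mevalC mxE exprMn.
under [X in _ = _ * (_ * X)]eq_bigr do rewrite rmorphXn /= mevalC.
rewrite big_split /= prod_exp_mdeg mulrACA; congr (_ * _).
by rewrite -dhomog_mevalZ //; apply: meval_eq => i; rewrite mxE.
Qed.

Lemma fev_dform z xi p :
  fev z xi (dform p) = \sum_(k < N.+1) (p^`M(k)).@[z 0] * xi 0 k.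
Proof. by rewrite rmorph_sum; apply: eq_bigr => k _; rewrite rmorphM /= fevC fevX. Qed.

Lemma fev_dformD z xi zeta p :
  fev z (xi + zeta) (dform p) = fev z xi (dform p) + fev z zeta (dform p).
Proof. by rewrite !fev_dform -big_split; apply: eq_bigr => k _; rewrite mxE mulrDr. Qed.

Lemma fev_dformZ z t xi p :
  fev z (t *: xi) (dform p) = t * fev z xi (dform p).
Proof. by rewrite !fev_dform mulr_sumr; apply: eq_bigr => k _; rewrite mxE mulrCA. Qed.

Lemma fev_dform_euler z p d : p \is d.-homog ->
  fev z z (dform p) = d%:R * p.@[z 0].
Proof.
move=> pd; rewrite fev_dform -mevalZ -(dhomog_euler pd) rmorph_sum.
by apply: eq_bigr => k _; rewrite /= mevalM mevalXU.
Qed.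

Lemma fev_dformM z xi p q : fev z xi (dform (p * q)) =
  fev z xi (dform p) * q.@[z 0] + p.@[z 0] * fev z xi (dform q).
Proof.
rewrite !fev_dform mulr_suml mulr_sumr -big_split; apply: eq_bigr => k _ /=.
by rewrite mderivM mevalD !mevalM mulrDl mulrAC mulrA.
Qed.

Lemma fev_dform_sum z xi (T : Type) (s : seq T) (F : T -> S) :
  fev z xi (dform (\sum_(i <- s) F i)) = \sum_(i <- s) fev z xi (dform (F i)).
Proof.
rewrite fev_dform; under [RHS]eq_bigr do rewrite fev_dform.
rewrite [RHS]exchange_big /=; apply: eq_bigr => k _.
by rewrite (linear_sum (mderiv k)) rmorph_sum mulr_suml.
Qed.

Lemma fev_dformXn z xi j n :
  fev z xi (dform ('X_j ^+ n)) = n%:R * z 0 j ^+ n.-1 * xi 0 j.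
Proof.
elim: n => [|n IHn].
  by rewrite expr0 fev_dform !mul0r big1 // => k _; rewrite -mpolyC1 mderivC meval0 mul0r.
rewrite exprS fev_dformM IHn mevalXU rmorphXn /= mevalXU.
have ->: fev z xi (dform 'X_j) = xi 0 j.
  rewrite fev_dform (bigD1 j) //= big1 => [|k kj]; last first.
    by rewrite mderivX mnm1E eq_sym (negPf kj) scale0r meval0 mul0r.
  rewrite mderivX mnm1E eqxx scale1r addr0.
  have ->: (U_(j) - U_(j))%MM = 0%MM :> 'X_{1..N.+1}.
    by apply/mnmP => i; rewrite mnmBE mnm0E subnn.
  by rewrite mpolyX0 meval1 mul1r.
(* The truncated [n.-1] is harmless at [n = 0], where its coefficient vanishes. *)
case: n {IHn} => [|n] /=; rewrite ?expr0 ?exprS -!natr1; ring.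
Qed.

End Forms.

(** * Signed maximal minors, derivatives, chart differentials and lines *)

Lemma maximal_minors_kernel (R : comNzRingType) n (M : 'M[R]_(n, n.+1))
    (v : 'I_n.+1 -> R) :
  (forall p, \sum_j M p j * v j = 0) -> forall j k : 'I_n.+1,
  (-1) ^+ k * \det (col' k M) * v j = (-1) ^+ j * \det (col' j M) * v k.
Proof.
(* [T] is [M] with the [k]-th unit row put on top, so [T] maps [v] to [v k] times the first unit
   vector. The identity is the [j]-th coordinate of adj(T) T v = det(T) v. *)
move=> Mv j k; pose T := \matrix_(i < n.+1, l < n.+1)
  if unlift ord0 i is Some p then M p l else (l == k)%:R.
have cofT l : cofactor T ord0 l = (-1) ^+ l * \det (col' l M).
  rewrite /cofactor add0n; congr (_ * \det _).
  by apply/matrixP=> p q; rewrite !mxE liftK.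
have detT : \det T = (-1) ^+ k * \det (col' k M).
  rewrite (expand_det_row _ ord0) (bigD1 k) //= big1 => [|l /negPf lk].
    by rewrite mxE unlift_none eqxx mul1r addr0.
  by rewrite mxE unlift_none lk mul0r.
have Tv : T *m (\col_l v l) = v k *: delta_mx ord0 0.
  apply/matrixP=> i l; rewrite !mxE ord1 eqxx andbT.
  case: (unliftP ord0 i) => [p|] ->; last first.
    rewrite eqxx mulr1 (bigD1 k) //= big1 => [|q /negPf qk].
      by rewrite !mxE unlift_none eqxx mul1r addr0.
    by rewrite !mxE unlift_none qk mul0r.
  rewrite eq_sym (negPf (neq_lift _ _)) mulr0 -[RHS](Mv p).
  by apply: eq_bigr => q _; rewrite !mxE liftK.
have := congr1 (fun X : 'cV_n.+1 => X j 0) (mulmxA (\adj T) T (\col_l v l)).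
rewrite Tv mul_adj_mx mul_scalar_mx -scalemxAr -colE detT !mxE cofT => <-.
by rewrite mulrC.
Qed.

(** The factor ['X_j] restores the degree lost by differentiation, which avoids a truncated
    [d - 1]. *)
Lemma dhomog_mulX_mderiv (R : comNzRingType) n d (p : {mpoly R[n]}) j k :
  p \is d.-homog -> 'X_j * p^`M(k) \is d.-homog.
Proof.
move=> /dhomog_mf pd; rewrite /mderiv mulr_sumr big_seq rpred_sum // => m /pd md.
rewrite -scalerAr; have [->|mk] := eqVneq (m k) 0%N.
  by rewrite mul0r scale0r rpred0.
rewrite rpredZ // -mpolyXD dhomogX; apply/eqP; rewrite -md /=.
have km : (U_(k) <= m)%MM by rewrite lep1mP.
by rewrite -{2}(submK km) !mdegD !mdeg1 addnC.
Qed.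

(** The quotient rule moves [xi] along [z] until its [k]-th coordinate vanishes, then divides by
    [z 0 k]; a form invariant under such moves thus only sees the rescaling. *)
Lemma dchartE (K : closedFieldType) n (k : 'I_n.+1) (z xi : 'rV[K]_n.+1) :
  z 0 k != 0 ->
  dchart k z xi = (z 0 k)^-1 *: (xi + (- (xi 0 k / z 0 k)) *: z).
Proof. by move=> zk; apply/rowP => j; rewrite !mxE; field. Qed.

Lemma line_gen (K : fieldType) (V : vectType K) (L : {vspace V}) (u : V) :
  \dim L = 1%N -> u \in L -> u != 0 -> L = <[u]>%VS.
Proof.
move=> dL uL u0; apply/eqP; rewrite eq_sym eqEdim -memvE uL.
by rewrite dim_vline u0 dL.
Qed.

(** * Lines in the cone, and products of twisted sections with polynomials *)

Section Cone.
Variables (K : closedFieldType) (n m a : nat).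
Variables (E : 'I_m -> {mpoly K[n.+1]}) (EV : 'I_a -> {mpoly K[n.+1]}).
Implicit Types (u : 'rV[K]_n.+1) (L : {vspace 'rV[K]_n.+1}).

Lemma in_proj_cone L u : in_proj E L -> u \in L -> u != 0 -> in_cone E u.
Proof. by move=> [_ EL] uL u0; split=> // i; apply: EL. Qed.

Lemma in_proj_coord L : in_proj E L ->
  exists k, forall u, u \in L -> u != 0 -> u 0 k != 0.
Proof.
move=> [dL _]; have L0 : vpick L != 0.
  by rewrite vpick0 -dimv_eq0 dL.
have /rV0Pn[k uk] := L0; exists k => u.
rewrite {1}(line_gen dL (memv_pick L) L0) => /vlineP[t ->].
by rewrite scaler_eq0 negb_or mxE mulf_eq0 negb_or => /andP[->].
Qed.

Lemma twisted_section_mul l h omega d (P : {mpoly K[n.+1]}) :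
  P \is d.-homog -> twisted_section EV E l h omega ->
  twisted_section EV E l (d%:Z + h) (form_mul P omega).
Proof.
move=> Pd [omega_eq omegaZ omega_reg]; rewrite /form_mul; split.
- by move=> L f g XL Vf Vg fg u uL u0; rewrite (omega_eq L f g).
- move=> L f XL Vf u t uL u0 t0; rewrite omegaZ // expfzDr // -exprnP.
  have ->: P.@[(t *: u) 0] = t ^+ d * P.@[u 0].
    by rewrite -dhomog_mevalZ //; apply: meval_eq => i; rewrite mxE.
  by rewrite mulrACA.
move=> L0 XL0; have [k [e [q [G [qe Ge Gl q0 omegaG]]]]] := omega_reg L0 XL0.
have [PGl PGe] := bihomogM (bihomogC Pd) (conj Gl Ge).
(* The generator of the new twist carries [d] more factors [u 0 k]; ['X_k ^+ d] in the denominator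
   cancels them and keeps both degrees equal to [d + e]. *)
exists k, (d + e)%N, ('X_k ^+ d * q), (P%:MP * G); split=> //.
- by apply: dhomogM => //; apply: dhomogXU_exp.
- move=> u uL u0; have [uk qu] := q0 u uL u0.
  by rewrite mevalM rmorphXn /= mevalXU mulf_neq0 ?expf_neq0.
move=> L f u XL Vf uL uk; rewrite mevalM rmorphXn /= mevalXU.
rewrite mulf_eq0 negb_or => /andP[ukd qu].
rewrite (omegaG L) // !fevE fevM fevC expfzDr // -exprnP.
by field; rewrite qu ukd.
Qed.

End Cone.

(** * The matrix C: bidegrees, displacement along z, and kernel *)

Section Fermat.
Variables (K : closedFieldType) (N c r : nat).
Local Notation S := {mpoly K[N.+1]}.
Variables (A : 'I_(c + r) -> 'I_N.+1 -> S) (lambda : 'I_N.+1 -> nat).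
Variable (d : 'I_(c + r) -> nat).
Hypothesis hlambda : forall j, (0 < lambda j)%N.
Hypothesis hA : forall i j, A i j != 0 ->
  exists2 m : nat, A i j \is m.-homog & (m + lambda j)%N = d i.
Implicit Types (z xi : 'rV[K]_N.+1).

Local Notation C := (matC A lambda).

(** Degree in z of row [i] after column [j] is scaled by a form of degree [lambda j]. In a B-row one
    of the [(d i').+1] degrees passes to the differential. *)
Definition zdeg (i : 'I_(c + r + c)) : nat :=
  match split i with inl i' => (d i').+1 | inr i' => d (lshift r i') end.

Definition xideg (i : 'I_(c + r + c)) : nat :=
  match split i with inl _ => 0 | inr _ => 1 end.

(* The factor z_k ^ lambda_j makes the degree independent of the column, and
   nonnegative. *)
Lemma bihomog_matC i j k :
  bihomog (zdeg i) (xideg i) (('X_k ^+ lambda j)%:MP * C i j).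
Proof.
rewrite mxE /zdeg /xideg; case: split => i'; rewrite mxE.
  rewrite -mpolyCM; apply: bihomogC.
  have [->|/hA[m Am <-]] := eqVneq (A i' j) 0; first by rewrite mul0r mulr0 rpred0.
  have ->: (m + lambda j).+1 = (lambda j + (m + 1))%N by rewrite addn1 addnS addnC.
  apply: dhomogM; first exact: dhomogXU_exp.
  by apply: dhomogM => //; rewrite dhomogX; apply/eqP/mdeg1.
have [->|/hA[m Am <-]] := eqVneq (A (lshift r i') j) 0.
  rewrite mpolyC0 !mulr0 mul0r addr0 /dform big1 ?mulr0; first exact: bihomog0.
  by move=> k' _; rewrite mderiv0 mpolyC0 mul0r.
rewrite addnC -[1%N]add0n; apply: bihomogM.
  by apply/bihomogC/dhomogXU_exp.
apply: bihomogD.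
  rewrite /dform mulr_sumr; apply: bihomog_sum => k' _.
  rewrite mulrA -mpolyCM -[m]addn0 -[1%N]add0n.
  by apply: bihomogM; [apply/bihomogC/dhomog_mulX_mderiv | apply: bihomogX].
rewrite -[m]addn0 -[1%N]add0n; apply: bihomogM; last exact: bihomogX.
by rewrite -[_%:R]mpolyC_nat -mpolyCM; apply: bihomogC; rewrite mulr_natl rpredMn.
Qed.

Lemma fev_matA z xi i j : fev z xi (C (lshift c i) j) = (A i j).@[z 0] * z 0 j.
Proof. by rewrite col_mxEu mxE fevC mevalM mevalXU. Qed.

Lemma fev_matB z xi i j : fev z xi (C (rshift (c + r) i) j) =
  z 0 j * fev z xi (dform (A (lshift r i) j))
  + (lambda j)%:R * (A (lshift r i) j).@[z 0] * xi 0 j.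
Proof.
rewrite col_mxEd mxE rmorphD !rmorphM /= !fevC fevX mevalXU.
by rewrite rmorph_nat.
Qed.

(** Euler's formula contributes deg A times the A-entry, and the dz-term contributes [lambda j]
    times it; the sum is the degree of the equation, the same in all columns. *)
Lemma fev_matB_shift z xi t i j :
  fev z (xi + t *: z) (C (rshift (c + r) i) j) =
  fev z xi (C (rshift (c + r) i) j)
  + t * (d (lshift r i))%:R * fev z xi (C (lshift c (lshift r i)) j).
Proof.
rewrite !fev_matB fev_matA fev_dformD fev_dformZ !mxE.
have [->|/hA[m Am <-]] := eqVneq (A (lshift r i) j) 0.
  have D0 w : fev z w (dform 0) = 0.
    by rewrite fev_dform big1 // => k _; rewrite mderiv0 meval0 mul0r.
  by rewrite !D0 !meval0; ring.
by rewrite (fev_dform_euler _ Am) natrD; ring.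
Qed.

(** The pairing reassembles [F_i] from an A-row and [dF_i] from a B-row. Since [lambda j] is
    positive, [lambda j - 1] is a true difference. *)
Lemma matC_kernel z xi i : in_cone (FX A lambda) z ->
  horizontal (FV A lambda) z xi ->
  \sum_j fev z xi (C i j) * z 0 j ^+ (lambda j - 1) = 0.
Proof.
move=> [_ Xz] Vxi; case: (split_ordP i) => i' ->.
  rewrite -[RHS](Xz i') rmorph_sum; apply: eq_bigr => j _ /=.
  by rewrite fev_matA mevalM rmorphXn /= mevalXU -mulrA -exprS subn1 prednK.
rewrite -[RHS](Vxi i') fevE fev_dform_sum; apply: eq_bigr => j _.
rewrite fev_matB fev_dformM fev_dformXn rmorphXn /= mevalXU subn1.
by rewrite -[in z 0 j ^+ lambda j](prednK (hlambda j)) exprS; ring.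
Qed.

End Fermat.

(** * Maximal minors as bihomogeneous forms *)

Section Minors.
Variables (K : closedFieldType) (c r l1 l2 : nat).
Local Notation N := (l1 + l2)%N.
Local Notation S := {mpoly K[N.+1]}.
Local Notation W := 'rV[K]_N.+1.
Variables (A : 'I_(c + r) -> 'I_N.+1 -> S) (lambda : 'I_N.+1 -> nat).
Variable (d : 'I_(c + r) -> nat).
Hypothesis hlambda : forall j, (0 < lambda j)%N.
Hypothesis hA : forall i j, A i j != 0 ->
  exists2 m : nat, A i j \is m.-homog & (m + lambda j)%N = d i.
Variables (I : 'I_l1 -> 'I_(c + r)) (J : 'I_l2 -> 'I_c).
Hypothesis hJI : forall q : 'I_l2, exists p : 'I_l1, I p = lshift r (J q).
Implicit Types (z xi u : W) (L : {vspace W}) (f : 'End(W)) (k : 'I_N.+1).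

Local Notation hl := (erefl N).
Local Notation FVA := (FV A lambda).
Local Notation FXA := (FX A lambda).
Local Notation M := (rowsub (row_sel I J) (matC A lambda)).

Lemma hatCE k : hatC A lambda hl I J k = col' k M.
Proof. by rewrite /hatC castmx_id. Qed.

Lemma row_sel_lshift p : row_sel I J (lshift l2 p) = lshift c (I p).
Proof. by rewrite /row_sel (unsplitK (inl p)). Qed.

Lemma row_sel_rshift q : row_sel I J (rshift l1 q) = rshift (c + r) (J q).
Proof. by rewrite /row_sel (unsplitK (inr q)). Qed.

Definition minor_deg : nat :=
  (\sum_(p < l1) (d (I p)).+1 + \sum_(q < l2) d (lshift r (J q)))%N.

(** The form G_k. The power of z_k is spread over the columns so that all entries of a row share a
    bidegree, as [bihomog_det] requires. *)
Definition minor_form k : symform K N :=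
  (-1) ^+ k *
  \det (\matrix_(p, j) (('X_k ^+ lambda (lift k j))%:MP * col' k M p j)).

Lemma bihomog_minor k : bihomog minor_deg l2 (minor_form k).
Proof.
have zdegE : (\sum_p zdeg d (row_sel I J p))%N = minor_deg.
  rewrite big_split_ord; congr addn; apply: eq_bigr => p _.
    by rewrite row_sel_lshift /zdeg (unsplitK (inl _)).
  by rewrite row_sel_rshift /zdeg (unsplitK (inr _)).
have xidegE : (\sum_p xideg (row_sel I J p))%N = l2.
  rewrite big_split_ord /= big1 => [|p _]; last first.
    by rewrite row_sel_lshift /xideg (unsplitK (inl _)).
  under eq_bigr do rewrite row_sel_rshift /xideg (unsplitK (inr _)).
  by rewrite sum1_card card_ord.
rewrite -zdegE -[X in bihomog _ X]xidegE.
apply/bihomog_sign/bihomog_det => p j; rewrite 3!mxE.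
exact: bihomog_matC.
Qed.

Lemma fev_minor z xi k : fev z xi (minor_form k) =
  (-1) ^+ k * z 0 k ^+ (\sum_(j < N) lambda (lift k j))
  * \det (map_mx (fev z xi) (col' k M)).
Proof.
rewrite /minor_form rmorphM /= rmorph_sign -mulrA fev_det; congr (_ * _).
have -> : map_mx (fev z xi) (\matrix_(p, j)
      (('X_k ^+ lambda (lift k j))%:MP * col' k M p j)) =
    map_mx (fev z xi) (col' k M) *m
      diag_mx (\row_j (z 0 k ^+ lambda (lift k j))).
  rewrite mul_mx_diag; apply/matrixP => p j.
  by rewrite !mxE rmorphM /= fevC rmorphXn /= mevalXU mulrC.
rewrite det_mulmx det_diag mulrC; congr (_ * _).
by rewrite expr_sum; apply: eq_bigr => j _; rewrite mxE.
Qed.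

(* By Euler's formula, moving xi along z adds to each B-row a multiple of the
   A-row of the same equation, which is among the selected rows. *)
Lemma fev_minor_shift z xi t k :
  fev z (xi + t *: z) (minor_form k) = fev z xi (minor_form k).
Proof.
have /fin_all_exists[sel selE] := hJI.
rewrite !fev_minor.
(* Row [q] of [T] has one possibly nonzero entry, in the column of the A-row of the equation [J q].
   Then [U] is unitriangular, of determinant 1, and performs all the row additions. *)
pose T : 'M[K]_(l2, l1) := \matrix_(q, p)
  (t * (d (lshift r (J q)))%:R *+ (p == sel q)).
pose U : 'M[K]_(l1 + l2) := block_mx 1%:M 0 T 1%:M.
have minorE w p j : map_mx (fev z w) (col' k M) p j =
    fev z w (matC A lambda (row_sel I J p) (lift k j)) by rewrite 3!mxE.
suff ->: map_mx (fev z (xi + t *: z)) (col' k M) =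
         U *m map_mx (fev z xi) (col' k M).
  by rewrite det_mulmx det_lblock !det1 !mul1r.
apply/matrixP => p j; rewrite [LHS]minorE [RHS]mxE big_split_ord /=.
case: (split_ordP p) => p' ->.
  under eq_bigr do rewrite block_mxEul mxE.
  under [X in _ = _ + X]eq_bigr do rewrite block_mxEur mxE mul0r.
  rewrite [X in _ = _ + X]big1 // addr0 (bigD1 p') //= eqxx mul1r.
  rewrite big1 => [|q /negPf qp]; last by rewrite eq_sym qp mul0r.
  by rewrite addr0 minorE row_sel_lshift !fev_matA.
under eq_bigr do rewrite block_mxEdl mxE.
under [X in _ = _ + X]eq_bigr do rewrite block_mxEdr mxE.
rewrite (bigD1 (sel p')) //= eqxx big1 => [|q /negPf qp]; last first.
  by rewrite qp mul0r.
rewrite (bigD1 p') //= eqxx mul1r big1 => [|q /negPf qp]; last first.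
  by rewrite eq_sym qp mul0r.
rewrite !minorE row_sel_lshift row_sel_rshift selE (fev_matB_shift hA).
by rewrite !addr0 addrC.
Qed.

(** * Gluing the local forms over the cone of X *)

Local Notation loc := (omega_hat_loc A lambda hl I J).

Lemma omega_hat_loc_det k z xi : loc k z xi =
  (-1) ^+ k / z 0 k ^+ (lambda k - 1) * \det (map_mx (fev z xi) (col' k M)).
Proof. by rewrite /omega_hat_loc hatCE -fev_det. Qed.

(** Once denominators are cleared, this is the proportionality of the signed minors to the kernel
    vector of [matC_kernel]. *)
Lemma omega_hat_loc_glue z xi j k : in_cone FXA z -> horizontal FVA z xi ->
  z 0 j != 0 -> z 0 k != 0 -> loc j z xi = loc k z xi.
Proof.
move=> Xz Vxi zj zk; rewrite !omega_hat_loc_det mulrAC [RHS]mulrAC.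
apply/eqP; rewrite eqr_div ?expf_neq0 //; apply/eqP.
rewrite !map_col'.
apply: (maximal_minors_kernel (v := fun l => z 0 l ^+ (lambda l - 1))) => p.
rewrite -[RHS](matC_kernel hlambda (row_sel I J p) Xz Vxi).
by apply: eq_bigr => l _; rewrite 2!mxE.
Qed.

Definition lambda_sum := (\sum_j lambda j)%N.

Lemma lambda_sum_lift k :
  lambda_sum = (lambda k + \sum_(j < N) lambda (lift k j))%N.
Proof. by rewrite /lambda_sum (bigD1_ord k). Qed.

Lemma lambda_sum_gt0 : (0 < lambda_sum)%N.
Proof. by rewrite (lambda_sum_lift ord0) addn_gt0 hlambda. Qed.

Lemma omega_hat_locE z xi k : z 0 k != 0 ->
  loc k z xi = fev z xi (minor_form k) / z 0 k ^+ lambda_sum.-1.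
Proof.
move=> zk; rewrite omega_hat_loc_det fev_minor.
have ->: lambda_sum.-1 =
    ((lambda k - 1) + \sum_(j < N) lambda (lift k j))%N.
  by rewrite (lambda_sum_lift k) addnC -subn1 -addnBA // addnC.
by rewrite exprD; field; rewrite !expf_neq0.
Qed.

(** The default 0 is reached only at [z = 0], outside the cone. *)
Definition omega_hat z xi : K :=
  if [pick j | z 0 j != 0] is Some j then loc j z xi else 0.

Lemma glued_omega_hatP : glued_omega_hat A lambda hl I J omega_hat.
Proof.
move=> k z xi Xz Vxi zk; rewrite /omega_hat.
case: pickP => [j zj|/(_ k)]; first exact: omega_hat_loc_glue.
by rewrite zk.
Qed.

Lemma omega_hatE z xi k :
  in_cone FXA z -> horizontal FVA z xi -> z 0 k != 0 ->
  omega_hat z xi = fev z xi (minor_form k) / z 0 k ^+ lambda_sum.-1.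
Proof. by move=> Xz Vxi zk; rewrite (glued_omega_hatP Xz Vxi zk) omega_hat_locE. Qed.

(** The chart picked depends on [z] alone, so both sides use the same one and neither the cone nor
    horizontality intervenes. *)
Lemma omega_hat_shift z xi t :
  omega_hat z (xi + t *: z) = omega_hat z xi.
Proof.
rewrite /omega_hat; case: pickP => [j zj|_]; last by [].
by rewrite !(omega_hat_locE _ zj) fev_minor_shift.
Qed.

Lemma omega_hat_hor_section : hor_section FVA FXA l2 omega_hat.
Proof.
split=> [z xi t _ _|z0 [z0n0 _]]; first exact: omega_hat_shift.
have /rV0Pn[k zk] := z0n0.
(* One more factor ['X_k] above and below makes the exponent positive by [lambda_sum_gt0], so that a
   nonzero denominator forces [z 0 k != 0]. *)
exists ('X_k ^+ lambda_sum), (('X_k)%:MP * minor_form k).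
have [Gl _] := bihomogM (bihomogC (dhomogXU_exp K k 1)) (bihomog_minor k).
split; [by rewrite rmorphXn /= mevalXU expf_neq0 | exact: Gl |].
move=> z xi Xz Vxi; rewrite rmorphXn /= mevalXU => qz.
have zk' : z 0 k != 0.
  by apply: contraNneq qz => ->; rewrite expr0n eqn0Ngt lambda_sum_gt0.
rewrite (omega_hatE Xz Vxi zk') fevE [in RHS]fevM fevC mevalXU.
rewrite -[in RHS](prednK lambda_sum_gt0) exprS.
by field; rewrite zk' expf_neq0.
Qed.

(** * The twist and the descent to X *)

Local Notation h := (heart lambda d I J).

(** In N + 1 = l1 + l2 + 1, [l1] counts the extra z of each A-row, [l2] the differentials, and 1
    turns Lambda into Lambda - 1. *)
Lemma heartE : h = minor_deg%:Z + l2%:Z - lambda_sum.-1%:Z.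
Proof.
have sumPosz n (F : 'I_n -> nat) : (\sum_i F i)%N%:Z = \sum_i (F i)%:Z.
  exact: (big_morph Posz PoszD (erefl _)).
have degS : (\sum_(p < l1) (d (I p)).+1 = \sum_(p < l1) d (I p) + l1)%N.
  under eq_bigr do rewrite -addn1.
  by rewrite big_split /= sum1_card card_ord.
rewrite /heart /minor_deg degS -subn1 -subzn ?lambda_sum_gt0 //.
rewrite !PoszD !sumPosz.
ring.
Qed.

Lemma omega_hatZ z xi t : t != 0 ->
  in_cone FXA z -> horizontal FVA z xi ->
  in_cone FXA (t *: z) -> horizontal FVA (t *: z) (t *: xi) ->
  omega_hat (t *: z) (t *: xi) = t ^ h * omega_hat z xi.
Proof.
move=> t0 Xz Vxi Xtz Vtxi; have /rV0Pn[k zk] := Xz.1.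
rewrite (omega_hatE Xz Vxi zk) (omega_hatE Xtz Vtxi (k := k)) ?mxE ?mulf_neq0 //.
rewrite (fevZ _ _ _ _ (bihomog_minor k)) heartE !expfzDr // -invr_expz -!exprnP.
by rewrite exprMn; field; rewrite !expf_neq0.
Qed.

Definition omega_form (L : {vspace W}) (f : 'End(W)) (u : W) : K := omega_hat u (f u).

Lemma omega_form_twisted : twisted_section FVA FXA l2 h omega_form.
Proof.
rewrite /omega_form; split.
- move=> L f g XL Vf Vg fg u uL u0.
  (* Two lifts of a tangent vector differ at [u] by an element of [L], that is, by a multiple of
     [u]. *)
  have := fg u uL; rewrite {1}(line_gen XL.1 uL u0) => /vlineP[t /eqP].
  by rewrite subr_eq addrC => /eqP ->; rewrite omega_hat_shift.
- move=> L f XL Vf u t uL u0 t0; have tuL : t *: u \in L by rewrite memvZ.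
  have tu0 : t *: u != 0 by rewrite scaler_eq0 negb_or t0.
  have := Vf _ tuL; rewrite linearZ => Vtf.
  apply: omega_hatZ => //; last exact: in_proj_cone XL tuL tu0.
    exact: in_proj_cone XL uL u0.
  exact: Vf.
move=> L0 XL0; have [k L0k] := in_proj_coord XL0.
have [Gl Ge] := bihomog_minor k.
exists k, minor_deg, ('X_k ^+ minor_deg), (minor_form k).
split=> //; first exact: dhomogXU_exp.
  by move=> u uL u0; rewrite rmorphXn /= mevalXU expf_neq0 ?(L0k u).
move=> L f u XL Vf uL uk _; rewrite rmorphXn /= mevalXU.
have u0 : u != 0 by apply: contraNneq uk => ->; rewrite mxE.
(* Passing to the chart costs [u 0 k] to the power [- l2]; with the denominator of exponent
   [minor_deg] and the twist [h], exactly the exponent - (Lambda - 1) of the glued form remains. *)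
have := fevZ 1 (u 0 k)^-1 u (f u + (- (f u 0 k / u 0 k)) *: u) (conj Gl Ge).
rewrite scale1r expr1n mul1r fev_minor_shift -dchartE // => fev_dchart.
rewrite (omega_hatE (in_proj_cone XL uL u0) (Vf u uL) uk).
rewrite -[feval _ _ _]/(fev _ _ _) fev_dchart heartE.
rewrite !expfzDr // -invr_expz -!exprnP exprVn.
by field; rewrite !expf_neq0.
Qed.

End Minors.

Theorem proposition6p10 (K : closedFieldType) (N c r : nat)
    (hN : (2 <= N)%N) (hNcr : (N <= 2 * c + r)%N) (hcr : (c + r <= N - 1)%N)
    (d : 'I_(c + r) -> nat) (lambda : 'I_N.+1 -> nat)
    (hd : forall i, (0 < d i)%N) (hlambda : forall j, (0 < lambda j)%N)
    (A : 'I_(c + r) -> 'I_N.+1 -> {mpoly K[N.+1]})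
    (hA : forall i j, A i j != 0 ->
            exists2 m : nat, A i j \is m.-homog & (m + lambda j)%N = d i)
    (hV : smooth_ci (FV A lambda)) (hX : smooth_ci (FX A lambda))
    (l1 l2 : nat) (hl2 : (0 < l2)%N) (hl12 : (l2 <= l1)%N)
    (hl : (l1 + l2)%N = N)
    (I : 'I_l1 -> 'I_(c + r)) (J : 'I_l2 -> 'I_c)
    (hI : forall p q : 'I_l1, (p < q)%N -> (I p < I q)%N)
    (hJ : forall p q : 'I_l2, (p < q)%N -> (J p < J q)%N)
    (hJI : forall q : 'I_l2, exists p : 'I_l1, I p = lshift r (J q)) :
  exists omega_hat : 'rV[K]_N.+1 -> 'rV[K]_N.+1 -> K,
    [/\ hor_section (FV A lambda) (FX A lambda) l2 omega_hat,
        glued_omega_hat A lambda hl I J omega_hat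
      & exists omega : {vspace 'rV[K]_N.+1} -> 'End('rV[K]_N.+1) ->
                       'rV[K]_N.+1 -> K,
        [/\ twisted_section (FV A lambda) (FX A lambda) l2
              (heart lambda d I J) omega,
            hor_eq (FV A lambda) (FX A lambda) (pi_pullback omega) omega_hat
          & forall (m : nat) (P : {mpoly K[N.+1]}), P \is m.-homog ->
              twisted_section (FV A lambda) (FX A lambda) l2
                (m%:Z + heart lambda d I J) (form_mul P omega)]].
Proof.
(* With N replaced by [l1 + l2], the cast in [hatC] becomes the identity. *)
subst N; exists (omega_hat A lambda I J); split.
- exact: (omega_hat_hor_section hlambda hA hJI).
- exact: glued_omega_hatP.
exists (omega_form A lambda I J).
have tw := omega_form_twisted hlambda hA hJI.
split; [exact: tw | move=> z xi [z0 _] _ | ]; last first.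
  by move=> m P Pm; apply: twisted_section_mul tw.
by rewrite /pi_pullback /omega_form dpiE.
Qed.
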